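(* Let $0<\alpha<1$ and $\beta>0$. Set $\kappa=\min(1/2,1-\alpha)-\delta$ for some arbitrarily small constant $\delta>0$ (i.e. $0<\delta<\min(1/2,1-\alpha)$) and take $R=N^\kappa$. Then, as $N\to\infty$, $$\mathbb E\bigl\langle\mathbf 1_{\{\chi_k=1,\ 1\le k\le R\}}\bigr\rangle\to1 .$$
   Context: Lévy spin glass model. Let $X$ be a symmetric real random variable with $\mathbb P(|X|>x)=L(x)/x^\alpha$ for all $x>0$, where $L:(0,\infty)\to(0,\infty)$ is slowly varying at $\infty$, i.e. $\lim_{x\to\infty}L(tx)/L(x)=1$ for every $t>0$. For $N\ge1$ set $a_N=\inf\{x>0: N\,\mathbb P(|X|>x)\le 1\}$ and $J=a_N^{-1}X$ ($a_N>0$ for all large $N$, and only large $N$ matter). Let $(J_{ij})_{1\le i<j\le N}$ be i.i.d. copies of $J$. For $\sigma\in\{-1,1\}^N$ let $-H_N(\sigma)=\beta\sum_{1\le i<j\le N}J_{ij}\sigma_i\sigma_j$, $Z_N=\sum_\sigma e^{-H_N(\sigma)}$, and $G_N(\sigma)=e^{-H_N(\sigma)}/Z_N$ (Gibbs measure); $\langle\cdot\rangle$ is the expectation over $\sigma$ sampled from $G_N$ given the disorder, and $\mathbb E$ is the expectation over the disorder. Let $n=N(N-1)/2$ and let $(U(k,1),U(k,2))$, $1\le k\le n$, with $1\le U(k,1)<U(k,2)\le N$, be the enumeration of the pairs such that $|J_{U(1,1),U(1,2)}|>|J_{U(2,1),U(2,2)}|>\cdots>|J_{U(n,1),U(n,2)}|$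 (if $|X|$ has atoms, the inequalities are non-strict and the decreasing ordering is chosen uniformly at random among the admissible ones). For $1\le k\le n$ let $$\chi_k=\chi_k(\sigma)=\mathbf 1_{\{\mathrm{sgn}(J_{U(k,1),U(k,2)}\,\sigma_{U(k,1)}\sigma_{U(k,2)})=1\}} .$$ *)

(* Defs.v *)
From mathcomp Require Import all_boot all_order all_algebra.
From mathcomp Require Import all_classical all_reals all_analysis.

Set Implicit Arguments.
Unset Strict Implicit.
Unset Printing Implicit Defensive.

Import Order.TTheory GRing.Theory Num.Theory.
Import numFieldNormedType.Exports.

Local Open Scope classical_set_scope.
Local Open Scope ring_scope.

Definition slowly_varying (R : realType) (L : R -> R) : Prop :=
  forall t : R, 0 < t -> L (t * x) / L x @[x --> +oo] --> (1 : R).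

Definition eq_law (R : realType) d1 (T1 : measurableType d1)
    (P1 : probability T1 R) d2 (T2 : measurableType d2)
    (P2 : probability T2 R) (X : T1 -> R) (Y : T2 -> R) : Prop :=
  forall A : set R, measurable A -> P1 (X @^-1` A) = P2 (Y @^-1` A).

Definition symmetric_law (R : realType) d (T : measurableType d)
    (P : probability T R) (X : T -> R) : Prop :=
  eq_law P P X (fun w => - X w).

Definition mutually_independent (R : realType) d (T : measurableType d)
    (P : probability T R) (I : finType) (Y : I -> T -> R) : Prop :=
  forall (S : {set I}) (A : I -> set R),
    (forall i, i \in S -> measurable (A i)) ->
    P (\bigcap_(i in [set` S]) (Y i @^-1` A i)) =
      (\prod_(i in S) P (Y i @^-1` A i))%E.

(* sigma(Y_i, i in I), as a collection of subsets of T *)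
Definition sigma_generated (R : realType) d (T : measurableType d)
    (I : Type) (Y : I -> T -> R) : set (set T) :=
  <<s [set B | exists i, exists2 A : set R, measurable A & B = Y i @^-1` A] >>.

(* a_N = inf {x > 0 : N P(|X| > x) <= 1}.  This can be 0 for small N, in which
   case a_N^-1 X is identically 0 because 0^-1 = 0. *)
Definition scaling (R : realType) d (T : measurableType d)
    (P : probability T R) (X : T -> R) (N : nat) : R :=
  inf [set x : R | 0 < x /\
    (N%:R%:E * P [set w | (x < `|X w|)%R] <= 1)%E].

Definition edge (N : nat) := {e : 'I_N * 'I_N | (e.1 < e.2)%N}.

Definition num_edges (N : nat) : nat := (N * (N - 1)) %/ 2.

Lemma card_edge N : #|{: edge N}| = num_edges N.
Proof.
rewrite card_sig /num_edges divn2 subn1 -bin2 -bin2_sum big_mkord -sum1_card.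
rewrite (eq_bigl (fun p : 'I_N * 'I_N => (p.1 < p.2)%N)); last by [].
rewrite -(pair_big_dep xpredT (fun i j : 'I_N => (i < j)%N) (fun _ _ => 1%N)).
rewrite (exchange_big_dep xpredT) //=; apply: eq_bigr => j _.
rewrite (big_ord_narrow (ltnW (ltn_ord j))).
by rewrite sum_nat_const card_ord muln1.
Qed.

(* k : 'I_(num_edges N) stands for the (k+1)-st pair
   (U(k+1,1), U(k+1,2)) of the enumeration. *)
Definition enumeration (N : nat) := {ffun 'I_(num_edges N) -> edge N}.

Definition decreasing_enum (R : realType) (N : nat) (x : edge N -> R)
    (u : enumeration N) : bool :=
  [&& injectiveb u, [forall e, exists k, u k == e] &
      [forall k : 'I_(num_edges N), forall l : 'I_(num_edges N),
        (k <= l)%N ==> (`|x (u l)| <= `|x (u k)|)]].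

(* Conditionally on sigma(J), U is uniformly distributed on the set of
   decreasing enumerations of J.  When the |J_e| are a.s. distinct, this says
   that U is a.s. the unique decreasing enumeration. *)
Definition uniform_decreasing_enum (R : realType) (N : nat) d
    (T : measurableType d) (P : probability T R) (J : edge N -> T -> R)
    (U : T -> enumeration N) : Prop :=
  forall u : enumeration N,
    measurable (U @^-1` [set u]) /\
    forall B : set T, sigma_generated J B ->
      P (B `&` U @^-1` [set u]) =
      (\int[P]_(w in B)
         ((decreasing_enum (J ^~ w) u)%:R
          / #|[set v | decreasing_enum (J ^~ w) v]%SET|%:R)%:E)%E.

(* sigma in {-1,1}^N, with true for +1 and false for -1 *)
Definition config (N : nat) := {ffun 'I_N -> bool}.

Section Model.
Context {R : realType} {N : nat}.

Definition spin (s : config N) (i : 'I_N) : R := if s i then 1 else -1.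

Definition bond (x : edge N -> R) (s : config N) (e : edge N) : R :=
  x e * spin s (val e).1 * spin s (val e).2.

Definition neg_hamiltonian (beta : R) (x : edge N -> R) (s : config N) : R :=
  beta * \sum_(e : edge N) bond x s e.

Definition partition_fun (beta : R) (x : edge N -> R) : R :=
  \sum_(s : config N) expR (neg_hamiltonian beta x s).

Definition gibbs (beta : R) (x : edge N -> R) (s : config N) : R :=
  expR (neg_hamiltonian beta x s) / partition_fun beta x.

Definition gibbs_avg (beta : R) (x : edge N -> R) (f : config N -> R) : R :=
  \sum_(s : config N) gibbs beta x s * f s.

Definition chi (x : edge N -> R) (u : enumeration N)
    (k : 'I_(num_edges N)) (s : config N) : R :=
  (Num.sg (bond x s (u k)) == 1)%:R.

(* indicator of {chi_k = 1 for all 1 <= k <= r}, with k shifted by one as in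
   enumeration *)
Definition all_chi (x : edge N -> R) (u : enumeration N) (r : R)
    (s : config N) : R :=
  [forall k : 'I_(num_edges N), (k.+1%:R <= r) ==> (chi x u k s == 1)]%:R.

End Model.

(* Main.v *)
Require Import Defs.
From mathcomp Require Import all_boot all_order all_algebra.
From mathcomp Require Import all_classical all_reals all_analysis.
From mathcomp Require Import measurable_realfun.
From mathcomp Require Import ring lra zify.

(** A bond of size |J_e| > A at a vertex whose other bonds have total size at
    most A / 2 is satisfied under the Gibbs measure up to an error
    exp (- beta A): flipping the spin at that vertex turns a configuration
    violating the bond into one of larger weight, by a factor at least
    exp (beta A) [gibbs_avg_dominant_bond].  So everything reduces to finding
    a level A such that, with probability tending to 1,
    - at least N^kappa bonds exceed A, hence the first N^kappa bonds of every
      decreasing enumeration do [large_top_edges];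
    - no bond exceeding A has at its first endpoint other bonds of total size
      more than A / 2;
    while N^kappa exp (- beta A) -> 0.

    Write f for the tail P(|J| > A), which is N^(-1) A^(- alpha) up to factors
    N^o(1).  The bonds are independent, so by Chebyshev the number of bonds
    above A is comparable with N^2 f as soon as N^2 f is large
    [chebyshev_count].  As alpha < 1, the truncated mean E min(|J|, A) is of
    the order of A f, so a given local field exceeds A / 2 with probability at
    most of the order of N f, whether or not the bond itself exceeds A; summing
    over the bonds, the second requirement fails with probability at most of
    the order of N^3 f^2 [crowded_le].  Thus N^2 f must exceed N^kappa while
    N^3 f^2 tends to 0, that is f must lie between N^(kappa - 2) and
    N^(- 3 / 2), which leaves room exactly because kappa < 1 / 2.  Then A is
    still larger than N^(1/2) / 2, so that the Gibbs error is negligible.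

    Only levels of the form x0 2^k are used.  Along them the tail of |X| is
    squeezed between two geometric sequences whose ratios are as close to
    2^(- alpha) as desired [tail_doubling], which replaces all integral
    estimates for regularly varying functions by geometric sums. *)

Set Implicit Arguments.
Unset Strict Implicit.
Unset Printing Implicit Defensive.

Import Order.TTheory GRing.Theory Num.Theory.
Import numFieldNormedType.Exports.
Local Open Scope classical_set_scope.
Local Open Scope ring_scope.

(** * Bonds dominating their local field *)

Section Deterministic.
Context {R : realType} {N : nat}.
Implicit Types (x : edge N -> R) (s : config N) (e f : edge N) (i : 'I_N).

Definition incident f i := ((val f).1 == i) || ((val f).2 == i).

Definition flip i s : config N := [ffun j => s j (+) (j == i)].

Definition local_field x e : R :=
  \sum_(f | incident f (val e).1 && (f != e)) `|x f|.

Lemma flipK i : involutive (flip i).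
Proof. by move=> s; apply/ffunP => j; rewrite !ffunE addbK. Qed.

Lemma spin_flip i s j : spin (flip i s) j = (-1) ^+ (j == i) * spin s j :> R.
Proof.
rewrite /spin ffunE; case: (j == i); case: (s j) => //=;
by rewrite ?expr1 ?expr0 ?mulN1r ?mul1r ?opprK.
Qed.

Lemma bond_flip x i s f :
  bond x (flip i s) f = (-1) ^+ incident f i * bond x s f.
Proof.
rewrite /bond !spin_flip /incident.
have : (val f).1 != (val f).2 by rewrite -val_eqE /= neq_ltn (valP f).
have [-> |_] := eqVneq (val f).1 i; have [-> |_] := eqVneq (val f).2 i;
  by rewrite ?eqxx //= => _; ring.
Qed.

Lemma normr_bond x s e : `|bond x s e| = `|x e|.
Proof.
by rewrite /bond !normrM /spin; do 2 case: ifP => _;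
  rewrite ?normrN normr1 !mulr1.
Qed.

Lemma neg_hamiltonian_flip beta x i s :
  neg_hamiltonian beta x (flip i s) =
  neg_hamiltonian beta x s - 2 * beta * \sum_(f | incident f i) bond x s f.
Proof.
rewrite /neg_hamiltonian [2 * beta]mulrC -mulrA -mulrBr; congr (_ * _).
rewrite (big_mkcond (incident^~ i)) mulr_sumr -sumrB; apply: eq_bigr => f _.
by rewrite bond_flip; case: ifP => _ /=; ring.
Qed.

Lemma partition_fun_gt0 beta x : 0 < partition_fun beta x.
Proof.
rewrite /partition_fun (bigD1 [ffun=> true]) //=.
by apply: ltr_wpDr; rewrite ?expR_gt0 // sumr_ge0 // => s _; exact: expR_ge0.
Qed.

Lemma gibbs_ge0 beta x s : 0 <= gibbs beta x s.
Proof. by rewrite divr_ge0 ?expR_ge0 // ltW ?partition_fun_gt0. Qed.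

Lemma gibbs_sum1 beta x : \sum_s gibbs beta x s = 1.
Proof.
by rewrite /gibbs -mulr_suml mulfV // gt_eqF // partition_fun_gt0.
Qed.

Lemma le_gibbs_avg beta x (f g : config N -> R) :
  (forall s, f s <= g s) -> gibbs_avg beta x f <= gibbs_avg beta x g.
Proof. by move=> fg; apply: ler_sum => s _; rewrite ler_wpM2l ?gibbs_ge0. Qed.

(** Flipping the spin at the first endpoint i of e changes the signs of
    exactly the bonds at i.  If e is violated, this raises the exponent by
    2 beta times (|x e| minus at most the local field), hence by at least
    2 beta a.  Since the flip is a bijection, the violating configurations
    weigh at most exp (- 2 beta a) times the partition function. *)
Lemma gibbs_avg_dominant_bond beta x e (a : R) : 0 <= beta -> 0 < a ->
  local_field x e + a <= `|x e| ->
  gibbs_avg beta x (fun s => (Num.sg (bond x s e) != 1)%:R)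
    <= expR (- (2 * beta * a)).
Proof.
move=> b0 a0 dom; set i := (val e).1.
have ie : incident e i by rewrite /incident eqxx.
have xe0 : 0 < `|x e|.
  by apply: lt_le_trans dom; rewrite ltr_wpDl// sumr_ge0.
have weight s : Num.sg (bond x s e) != 1 ->
    expR (neg_hamiltonian beta x s) <=
    expR (- (2 * beta * a)) * expR (neg_hamiltonian beta x (flip i s)).
  move=> sb; rewrite -expRD ler_expR neg_hamiltonian_flip.
  have bE : bond x s e = - `|x e|.
    rewrite -(normr_bond x s e) ler0_norm ?opprK// leNgt.
    by apply: contra sb => /gtr0_sg ->.
  rewrite (bigD1 e) //= bE.
  have : \sum_(f | incident f i && (f != e)) bond x s f <= local_field x e.
    by apply: ler_sum => f _; rewrite (le_trans (ler_norm _)) // normr_bond.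
  set S := \sum_(f | _) _ => SL.
  have : 0 <= 2 * beta * (`|x e| - S - a).
    by rewrite mulr_ge0 ?mulr_ge0// -addrA -opprD subr_ge0;
      apply: le_trans dom; rewrite lerD2r.
  by move: (neg_hamiltonian _ _ _) => h; nra.
rewrite /gibbs_avg.
have Z0 := partition_fun_gt0 beta x.
under eq_bigr do rewrite /gibbs mulrAC.
rewrite -mulr_suml ler_pdivrMr// /partition_fun.
rewrite [in leRHS](reindex_inj (inv_inj (flipK i))) /= mulr_sumr.
apply: ler_sum => s _; case: (boolP (_ != _)) => sb.
  by rewrite mulr1 weight.
by rewrite mulr0 mulr_ge0 ?expR_ge0.
Qed.

Lemma le_card_initial (n : nat) (r : R) : 0 <= r ->
  #|[pred k : 'I_n | k.+1%:R <= r]|%:R <= r.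
Proof.
move=> r0; apply: le_trans (_ : (Num.truncn r)%:R <= r); last first.
  by rewrite truncn_le.
rewrite ler_nat cardE -(size_map val) -[leqRHS](size_iota 0).
apply: uniq_leq_size; first by rewrite (map_inj_uniq val_inj) enum_uniq.
move=> _ /mapP[k + ->]; rewrite mem_enum inE /= mem_iota /= add0n => kr.
by rewrite truncn_ge_nat.
Qed.

(** If |x (u k)| were at most A, so would be all later bonds, and only the k
    first ones could exceed A, fewer than r. *)
Lemma large_top_edges x (u : enumeration N) (A r : R) (k : 'I_(num_edges N)) :
  decreasing_enum x u -> r <= #|[pred e | A < `|x e|]|%:R ->
  k.+1%:R <= r -> A < `|x (u k)|.
Proof.
move=> /and3P[/injectiveP u_inj /forallP u_surj /forallP u_dec] rA kr.
rewrite ltNge; apply/negP => ukA.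
set B := [pred e | A < `|x e|].
have : (#|B| <= k)%N.
  have sub : B \subset
      [set u (widen_ord (ltnW (ltn_ord k)) l) | l : 'I_k].
    apply/fintype.subsetP => e; rewrite inE => Ae.
    have /existsP[l /eqP ule] := u_surj e.
    have lk : (l < k)%N.
      rewrite ltnNge; apply/negP => kl.
      have /forallP/(_ l)/implyP/(_ kl) := u_dec k.
      by rewrite ule leNgt (le_lt_trans ukA Ae).
    apply/imsetP; exists (Ordinal lk) => //; rewrite -ule; congr (u _).
    exact/val_inj.
  apply: leq_trans (subset_leq_card sub) _.
  by rewrite (leq_trans (leq_imset_card _ _)) // card_ord.
apply/negP; rewrite -ltnNge -(ltr_nat R).
by apply: lt_le_trans rA; apply: lt_le_trans kr; rewrite ltr_nat.
Qed.

(** The requirement on the disorder under which the top r bonds are satisfied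
    with high Gibbs probability. *)
Definition dominant_top x (A r : R) :=
  (r <= #|[pred e | A < `|x e|]|%:R) &&
  [forall e, (A < `|x e|) ==> (local_field x e <= A / 2)].

Lemma chi_eq1 x (u : enumeration N) (k : 'I_(num_edges N)) s :
  (chi x u k s == 1) = (Num.sg (bond x s (u k)) == 1).
Proof. by rewrite /chi pnatr_eq1 eqb1. Qed.

(** The union bound, pointwise in the configuration. *)
Lemma all_chi_ge x (u : enumeration N) (r : R) s :
  1 - \sum_(k < num_edges N | k.+1%:R <= r) (Num.sg (bond x s (u k)) != 1)%:R
    <= all_chi x u r s.
Proof.
rewrite /all_chi; case: forallP => [_|nall].
  by rewrite gerBl sumr_ge0 // => k _; rewrite ler0n.
have [k] : exists k : 'I_(num_edges N),
    ~~ ((k.+1%:R <= r) ==> (chi x u k s == 1)).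
  by apply/existsP; rewrite -negb_forall; apply/forallP.
rewrite negb_imply chi_eq1 => /andP[kr bad].
rewrite (bigD1 k) //= bad subr_le0 lerDl sumr_ge0 // => l _.
Qed.

Lemma gibbs_avg_all_chi_ge beta x (u : enumeration N) (A r : R) :
  0 <= beta -> 0 < A -> 0 <= r -> decreasing_enum x u -> dominant_top x A r ->
  1 - r * expR (- (beta * A)) <= gibbs_avg beta x (all_chi x u r).
Proof.
move=> b0 A0 r0 u_dec /andP[rA /forallP dom].
apply: le_trans (le_gibbs_avg beta x (all_chi_ge x u r)).
rewrite {1}/gibbs_avg; under eq_bigr do rewrite mulrBr mulr1 mulr_sumr.
rewrite sumrB gibbs_sum1 lerD2l lerN2 exchange_big /=.
apply: (@le_trans _ _
  (\sum_(k < num_edges N | k.+1%:R <= r) expR (- (beta * A)))).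
  apply: ler_sum => k kr.
  have xA := large_top_edges u_dec rA kr.
  have -> : beta * A = 2 * beta * (A / 2) by field.
  apply: gibbs_avg_dominant_bond; rewrite ?divr_gt0 //.
  have /implyP/(_ xA) := dom (u k); lra.
by rewrite sumr_const -mulr_natl ler_wpM2r ?expR_ge0 ?le_card_initial.
Qed.

Lemma gibbs_avg_all_chi_itv beta x (u : enumeration N) (r : R) :
  0 <= gibbs_avg beta x (all_chi x u r) <= 1.
Proof.
apply/andP; split.
  by apply: sumr_ge0 => s _; rewrite mulr_ge0 ?gibbs_ge0 // ler0n.
rewrite -(gibbs_sum1 beta x); apply: ler_sum => s _.
by rewrite ler_piMr ?gibbs_ge0 // /all_chi; case: [forall _, _].
Qed.
End Deterministic.

(** * Boolean events and means of nonnegative random variables *)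

Section BooleanEvents.
Context d (T : measurableType d) (R : realType).

Lemma measurable_pred (b : T -> bool) :
  measurable_fun setT b -> measurable [set w | b w].
Proof.
move=> mb; have := mb measurableT [set true] I.
by rewrite setTI.
Qed.

Lemma measurable_fun_forall (I : finType) (b : I -> T -> bool) :
  (forall i, measurable_fun setT (b i)) ->
  measurable_fun setT (fun w => [forall i, b i w]).
Proof.
move=> mb; apply: (measurable_fun_bool true); rewrite setTI.
rewrite (_ : _ @^-1` _ = \bigcap_(i in [set: I]) [set w | b i w]).
  by apply: fin_bigcap_measurable => // i _; exact: measurable_pred.
apply/seteqP; split=> w /= => [/forallP bw i _|bw]; first exact: bw.
by apply/forallP => i; exact: bw.
Qed.

Lemma measurable_fun_implyl (c : bool) (b : T -> bool) :
  measurable_fun setT b -> measurable_fun setT (fun w => c ==> b w).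
Proof. by move=> mb; case: c => /=; [exact: mb|exact: measurable_cst]. Qed.

Lemma indic_pred (b : T -> bool) w : \1_[set w | b w] w = (b w)%:R :> R.
Proof.
by rewrite indicE; congr (_%:R); congr nat_of_bool; apply/idP/idP; rewrite inE.
Qed.

Lemma measurable_fun_natb (b : T -> bool) :
  measurable_fun setT b -> measurable_fun setT (fun w => (b w)%:R : R).
Proof.
move=> /measurable_pred mb.
apply: eq_measurable_fun (measurable_indic mb) => w _.
exact: indic_pred.
Qed.

Lemma measurable_lt_norm (f : T -> R) (t : R) :
  measurable_fun setT f -> measurable_fun setT (fun w => t < `|f w|).
Proof.
move=> mf; apply: measurable_fun_ltr; first exact: measurable_cst.
by apply: measurableT_comp => //; exact: normr_measurable.
Qed.

Lemma card_sum_natb (I : finType) (b : pred I) :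
  #|[pred i | b i]|%:R = \sum_i (b i)%:R :> R.
Proof.
rewrite -sum1_card natr_sum big_mkcond.
by apply: eq_bigr => i _; rewrite inE; case: (b i).
Qed.

Lemma measurable_card (I : finType) (b : I -> T -> bool) :
  (forall i, measurable_fun setT (b i)) ->
  measurable_fun setT (fun w => #|[pred i | b i w]|%:R : R).
Proof.
move=> mb; under eq_fun do rewrite card_sum_natb.
by apply: measurable_sum => i; exact: measurable_fun_natb.
Qed.
End BooleanEvents.

Section HasMean.
Context d (T : measurableType d) (R : realType) (P : probability T R).
Implicit Types (f g : T -> R) (v : R).

(** Carrying measurability and sign along with the value of the mean lets
    Markov- and Chebyshev-type bounds be read off pointwise inequalities
    between finite combinations of indicators, through le_has_mean. *)
Definition has_mean f v :=
  [/\ measurable_fun setT f, forall w, 0 <= f w &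
      (\int[P]_w (f w)%:E = v%:E)%E].

Lemma has_mean_pred (b : T -> bool) : measurable_fun setT b ->
  has_mean (fun w => (b w)%:R) (fine (P [set w | b w])).
Proof.
move=> mb; split=> [|//|]; first exact: measurable_fun_natb.
have mB := measurable_pred mb.
under eq_integral do rewrite -indic_pred.
by rewrite integral_indic// setIT fineK// fin_num_measure.
Qed.

Lemma has_mean_cst v : 0 <= v -> has_mean (cst v) v.
Proof.
move=> v0; split=> [|//|]; first exact: measurable_cst.
transitivity (\int[P]_(w in setT) (cst v%:E w))%E => //.
by rewrite integral_cst// [X in (_ * X)%E]probability_setT mule1.
Qed.

Lemma has_meanD f g u v : has_mean f u -> has_mean g v ->
  has_mean (fun w => f w + g w) (u + v).
Proof.
move=> [mf f0 fu] [mg g0 gv]; split=> [|w|].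
- exact: measurable_funD.
- exact: addr_ge0.
- under eq_integral do rewrite EFinD.
  rewrite ge0_integralD// ?fu ?gv//; try exact/measurable_EFinP.
  + by move=> w _; rewrite lee_fin.
  + by move=> w _; rewrite lee_fin.
Qed.

Lemma has_meanZ c f u : 0 <= c -> has_mean f u ->
  has_mean (fun w => c * f w) (c * u).
Proof.
move=> c0 [mf f0 fu]; split=> [|w|].
- by apply: measurable_funM => //; exact: measurable_cst.
- exact: mulr_ge0.
- under eq_integral do rewrite EFinM.
  rewrite ge0_integralZl ?fu//; first exact/measurable_EFinP.
  by move=> w _; rewrite lee_fin.
Qed.

Lemma has_mean_sum (I : Type) (s : seq I) (Q : pred I) (f : I -> T -> R)
    (u : I -> R) :
  (forall i, Q i -> has_mean (f i) (u i)) ->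
  has_mean (fun w => \sum_(i <- s | Q i) f i w) (\sum_(i <- s | Q i) u i).
Proof.
move=> fu; elim: s => [|i s IH].
  under eq_fun do rewrite big_nil; rewrite big_nil; exact: has_mean_cst.
under eq_fun do rewrite big_cons; rewrite big_cons.
by case: ifPn => // Qi; apply: has_meanD => //; exact: fu.
Qed.

Lemma le_has_mean f g u v : has_mean f u -> has_mean g v ->
  (forall w, f w <= g w) -> u <= v.
Proof.
move=> [mf f0 fu] [mg g0 gv] fg; rewrite -lee_fin -fu -gv.
apply: ge0_le_integral => //.
- by move=> w _; rewrite lee_fin.
- exact/measurable_EFinP.
- exact/measurable_EFinP.
- by move=> w _; rewrite lee_fin.
Qed.

Lemma has_mean_bounded f : measurable_fun setT f ->
  (forall w, 0 <= f w <= 1) -> exists v, has_mean f v.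
Proof.
move=> mf f01; have f0 w : 0 <= f w by case/andP: (f01 w).
exists (fine (\int[P]_w (f w)%:E)%E); split => //; rewrite fineK//.
rewrite ge0_fin_numE; last by apply: integral_ge0 => w _; rewrite lee_fin.
apply: (@le_lt_trans _ _ (\int[P]_w (cst 1 w)%:E)%E); last first.
  by case: (has_mean_cst ler01) => _ _ ->; rewrite ltry.
apply: ge0_le_integral => //.
- by move=> w _; rewrite lee_fin.
- exact/measurable_EFinP.
- exact/measurable_EFinP.
- by move=> w _; rewrite lee_fin; case/andP: (f01 w).
Qed.
End HasMean.

(** * Counting pairwise independent events *)

Section Events.
Context d (T : measurableType d) (R : realType) (P : probability T R).

Let pr (b : T -> bool) : R := fine (P [set w | b w]).

(** With c the number of events that occur, (c - m)^2 has mean at most m.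
    Expanding the square as c^2 + m^2 = (c - m)^2 + 2 m c avoids subtracting
    random variables: when c <= m / 2, (m / 2)^2 + 2 m c <= c^2 + m^2. *)
Lemma chebyshev_count (I : finType) (b : I -> T -> bool) (p : R) :
  (forall i, measurable_fun setT (b i)) ->
  (forall i, pr (b i) = p) ->
  (forall i j, i != j -> pr (fun w => b i w && b j w) = p * p) ->
  let m := #|I|%:R * p in 0 < m ->
  pr (fun w => #|[pred i | b i w]|%:R <= m / 2) <= 4 / m.
Proof.
move=> mb bp bb m m0.
have p0 : 0 <= p.
  by rewrite leNgt; apply/negP => p0; move: m0; rewrite ltNge mulr_ge0_le0 // ltW.
have mcard : measurable_fun setT (fun w => #|[pred i | b i w]|%:R : R).
  exact: measurable_card.
have ms : measurable_fun setT (fun w => #|[pred i | b i w]|%:R <= m / 2).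
  by apply: measurable_fun_ler => //; exact: measurable_cst.
have c1 := has_mean_sum (index_enum I) (fun i (_ : true) => has_mean_pred P (mb i)).
have lhs := has_meanD (has_meanZ (sqr_ge0 (m / 2)) (has_mean_pred P ms))
                      (has_meanZ (ltW (mulr_gt0 (ltr0Sn R 1) m0)) c1).
have mbb i j : measurable_fun setT (fun w => b i w && b j w).
  exact: measurable_and.
have c2 := has_mean_sum (index_enum I) (fun i (_ : true) =>
  has_mean_sum (index_enum I) (fun j (_ : true) => has_mean_pred P (mbb i j))).
have rhs := has_meanD c2 (has_mean_cst P (sqr_ge0 m)).
have := le_has_mean lhs rhs.
have -> : \sum_i fine (P [set w | b i w]) = m.
  by under eq_bigr do rewrite [fine _]bp; rewrite sumr_const -mulr_natl.
have bound : \sum_i \sum_j fine (P [set w | b i w && b j w]) <= m + m ^+ 2.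
  apply: (@le_trans _ _ (\sum_(i : I) (p + #|I|%:R * p * p))); last first.
    by rewrite sumr_const -[(p + _) *+ _]mulr_natl mulrDr lerD2l expr2 -/m mulrCA.
  apply: ler_sum => i _; rewrite (bigD1 i) //= lerD //.
    by rewrite -(bp i) /pr; under eq_set do rewrite andbb.
  apply: (@le_trans _ _ (\sum_(j : I) p * p)); last first.
    by rewrite sumr_const -mulrA mulr_natl.
  rewrite [leRHS](bigD1 i) //= ler_wpDl ?mulr_ge0//.
  by apply: ler_sum => j ij; rewrite [fine _]bb// eq_sym.
clearbody m.
rewrite -[fine (P [set w | #|_|%:R <= _])]/(pr _).
move: (pr _) bound => q bound H.
have {}H : (m / 2) ^+ 2 * q + 2 * m * m <= m + m ^+ 2 + m ^+ 2.
  apply: le_trans (lerD bound (lexx (m ^+ 2))).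
  apply: H => w; rewrite -card_sum_natb.
  have -> : \sum_i \sum_j (b i w && b j w)%:R = (\sum_i (b i w)%:R) ^+ 2 :> R.
    rewrite expr2 mulr_suml; apply: eq_bigr => i _; rewrite mulr_sumr.
    by apply: eq_bigr => j _; rewrite -natrM mulnb.
  rewrite -card_sum_natb; move: (#|_|%:R) => c; rewrite /=.
  have [cm|cm] := lerP c (m / 2); rewrite ?mulr1 ?mulr0.
    have : 0 <= (m / 2 - c) * (3 * m / 2 - c) by rewrite mulr_ge0//; lra.
    by lra.
  have : 0 <= (m - c) ^+ 2 by exact: sqr_ge0.
  by lra.
rewrite ler_pdivlMr// -(ler_pM2r m0); nra.
Qed.

Lemma independent_pair (I : finType) (Y : I -> {RV P >-> R}) (A B : set R) i j :
  mutually_independent P (fun e => Y e : T -> R) -> i != j ->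
  measurable A -> measurable B ->
  P (Y i @^-1` A `&` Y j @^-1` B) = (P (Y i @^-1` A) * P (Y j @^-1` B))%E.
Proof.
move=> indep ij mA mB.
have := indep [set i; j]%SET (fun k => if k == i then A else B).
rewrite big_setU1 ?inE//= big_set1 eqxx eq_sym (negbTE ij) => <-; last first.
  by move=> k _; case: ifP.
congr (P _); apply/seteqP; split=> w /=.
  move=> [Aw Bw] k /=; rewrite !inE => /orP[] /eqP ->; first by rewrite eqxx.
  by rewrite eq_sym (negbTE ij).
move=> AB; split.
  by have := AB i; rewrite /= !inE eqxx; exact.
by have := AB j; rewrite /= !inE eqxx orbT eq_sym (negbTE ij); exact.
Qed.
End Events.

(** * Large bonds with a large local field *)

Section Dyadic.
Context {R : realType}.

(** A staircase with steps at the levels a 2^k, k < K; the step at a 2^k has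
    height a 2^k, so that the staircase climbs exactly to the next level. *)
Definition dyadic_step (a : R) (K : nat) (t : R) : R :=
  a * (1 + \sum_(k < K) 2 ^+ k * (a * 2 ^+ k < t)%R%:R).

Lemma dyadic_step_ge0 a K t : 0 <= a -> 0 <= dyadic_step a K t.
Proof.
by move=> a0; rewrite mulr_ge0// addr_ge0// sumr_ge0.
Qed.

Lemma le_dyadic_step a K t : 0 <= a ->
  Num.min t (a * 2 ^+ K) <= dyadic_step a K t.
Proof.
move=> a0; elim: K => [|K IH].
  by rewrite /dyadic_step big_ord0 addr0 expr0 ge_min lexx orbT.
rewrite {1}/dyadic_step big_ord_recr /= addrA mulrDr -/(dyadic_step a K t).
have a2 : 0 <= a * 2 ^+ K by rewrite mulr_ge0// exprn_ge0.
have [ta|ta] := lerP t (a * 2 ^+ K).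
  rewrite ge_min; apply/orP; left.
  rewrite !mulr0 addr0; apply: le_trans IH; by rewrite le_min lexx.
rewrite mulr1 ge_min; apply/orP; right.
have : a * 2 ^+ K <= dyadic_step a K t.
  by apply: le_trans IH; rewrite le_min lexx andbT ltW.
by rewrite exprS; lra.
Qed.

(** Truncation at the level A = a 2^K does not affect whether a sum of
    nonnegative terms reaches A / 2: either nothing is truncated, or one
    truncated term reaches it alone. *)
Lemma dyadic_step_sum_ge a K (I : finType) (Q : pred I) (t : I -> R) :
  0 <= a -> (forall i, 0 <= t i) ->
  a * 2 ^+ K / 2 <= \sum_(i | Q i) t i ->
  a * 2 ^+ K / 2 <= \sum_(i | Q i) dyadic_step a K (t i).
Proof.
move=> a0 t0 tS.
have [/existsP[i /andP[Qi ti]]|small] :=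
    boolP [exists i, Q i && (a * 2 ^+ K < t i)].
  rewrite (bigD1 i) //=; apply: (@le_trans _ _ (a * 2 ^+ K)).
    by rewrite ler_pdivrMr // ler_peMr ?mulr_ge0 ?exprn_ge0// ler1n.
  rewrite -[leLHS]addr0 lerD ?sumr_ge0//.
    by apply: le_trans (le_dyadic_step K (t i) a0); rewrite le_min lexx andbT ltW.
  by move=> j _; exact: dyadic_step_ge0.
apply: le_trans tS _; apply: ler_sum => i Qi.
apply: le_trans (le_dyadic_step K (t i) a0); rewrite le_min lexx /= leNgt.
by move: small; rewrite negb_exists => /forallP/(_ i); rewrite Qi.
Qed.
End Dyadic.

(** An edge at i is determined by which of its endpoints is i and by the other
    endpoint. *)
Lemma card_incident N (i : 'I_N) :
  (#|[pred f : edge N | incident f i]| <= 2 * N)%N.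
Proof.
pose endpoint (h : bool) (f : edge N) := if h then (val f).1 else (val f).2.
pose B h := [pred f : edge N | endpoint h f == i].
have cardB h : (#|B h| <= N)%N.
  rewrite -[leqRHS]card_ord -(@card_in_image _ _ (endpoint (~~ h)) (B h)) ?max_card//.
  move=> f g; rewrite !inE /endpoint => /eqP fi /eqP gi fg.
  apply: val_inj; move: fi gi fg; case: (val f) => a b; case: (val g) => a' b'.
  by case: h => /= -> -> ->.
rewrite mul2n -addnn; apply: leq_trans (leq_add (cardB true) (cardB false)).
rewrite -[leqRHS]cardUI; apply: leq_trans (leq_addr _ _); apply: subset_leq_card.
by apply/fintype.subsetP => f; rewrite !inE.
Qed.

Section LocalField.
Context (R : realType) (N : nat) d (T : measurableType d) (P : probability T R).
Context (Y : edge N -> {RV P >-> R}) (a : R) (F : nat -> R) (K : nat).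
Hypothesis Y_indep : mutually_independent P (fun e => Y e : T -> R).
Hypothesis a_gt0 : 0 < a.
Hypothesis tailY : forall e k, fine (P [set w | a * 2 ^+ k < `|Y e w|]) = F k.

Let A : R := a * 2 ^+ K.

Lemma measurable_exceeds e (t : R) : measurable_fun setT (fun w => t < `|Y e w|).
Proof. exact: measurable_lt_norm. Qed.

Lemma tail_pair e f k l : e != f ->
  fine (P [set w | (a * 2 ^+ k < `|Y e w|) && (a * 2 ^+ l < `|Y f w|)]) =
  F k * F l.
Proof.
move=> ef; rewrite -(tailY e) -(tailY f).
pose B (t : R) := [set x : R | t < `|x|].
have mB t : measurable (B t).
  exact: (measurable_pred (measurable_lt_norm t (@measurable_id _ R setT))).
rewrite -fineM; last 2 first.
- by rewrite fin_num_measure//; exact: (measurable_pred (measurable_exceeds _ _)).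
- by rewrite fin_num_measure//; exact: (measurable_pred (measurable_exceeds _ _)).
rewrite -(independent_pair Y_indep ef (mB _) (mB _)); congr (fine (P _)).
by apply/seteqP; split=> w /= /andP.
Qed.

Lemma measurable_local_field e :
  measurable_fun setT (fun w => local_field (Y ^~ w) e).
Proof.
rewrite /local_field; under eq_fun do rewrite big_mkcond.
apply: measurable_sum => f; case: (incident f _ && _); last exact: measurable_cst.
by apply: measurableT_comp => //; exact: normr_measurable.
Qed.

Definition crowded w :=
  [exists e, (A < `|Y e w|) && (A / 2 < local_field (Y ^~ w) e)].

Lemma measurable_crowded : measurable_fun setT crowded.
Proof.
rewrite (_ : crowded = fun w => ~~ [forall e,
  ~~ ((A < `|Y e w|) && (A / 2 < local_field (Y ^~ w) e))]); last first.
  by apply/funext => w; rewrite negb_forall; apply: eq_existsb => e; rewrite negbK.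
apply: measurable_neg; apply: measurable_fun_forall => e.
apply: measurable_neg; apply: measurable_and; first exact: measurable_exceeds.
by apply: measurable_fun_ltr; [exact: measurable_cst|exact: measurable_local_field].
Qed.

(** Markov's inequality, applied to the sum over pairs of neighbouring bonds
    (e, f) of the indicator of |Y e| > A times the staircase at |Y f|.  Such a
    product is a combination of indicators of intersections of two tail
    events, so that its mean follows from pairwise independence. *)
Lemma crowded_le : fine (P [set w | crowded w]) <=
  4 * #|{: edge N}|%:R * N%:R * F K * (1 + \sum_(k < K) 2 ^+ k * F k) / 2 ^+ K.
Proof.
pose adj (e : edge N) := [pred f : edge N | incident f (val e).1 & f != e].
have F0 k (e : edge N) : 0 <= F k by rewrite -(tailY e) fine_ge0.
have mean e f : adj e f ->
    has_mean P (fun w => (A < `|Y e w|)%R%:R * dyadic_step a K `|Y f w|)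
      (a * (F K + \sum_(k < K) 2 ^+ k * (F K * F k))).
  move=> /andP[_ fe].
  rewrite (_ : (fun w => _) = (fun w => a * ((A < `|Y e w|)%R%:R +
    \sum_(k < K) 2 ^+ k *
      ((A < `|Y e w|) && (a * 2 ^+ k < `|Y f w|))%R%:R))); last first.
    apply/funext => w; rewrite /dyadic_step mulrCA; congr (_ * _).
    rewrite mulrDr mulr1 mulr_sumr; congr (_ + _); apply: eq_bigr => k _.
    by rewrite mulrCA -natrM mulnb.
  apply: has_meanZ; first exact: ltW.
  apply: has_meanD.
    by rewrite -(tailY e); apply: has_mean_pred; exact: measurable_exceeds.
  apply: has_mean_sum => k _; apply: has_meanZ; first exact: exprn_ge0.
  rewrite -(tail_pair K k (_ : e != f)); last by rewrite eq_sym.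
  by apply: has_mean_pred; apply: measurable_and; exact: measurable_exceeds.
have rhs := has_mean_sum (index_enum (edge N)) (fun e (_ : true) =>
  has_mean_sum (index_enum (edge N)) (mean e)).
have A0 : 0 < A by rewrite mulr_gt0// exprn_gt0.
have lhs := has_meanZ (ltW (divr_gt0 A0 (ltr0Sn R 1)))
  (has_mean_pred P measurable_crowded).
have {lhs rhs} := le_has_mean lhs rhs.
set S := a * _; move=> H.
have S0 (e : edge N) : 0 <= S.
  rewrite mulr_ge0 ?(ltW a_gt0) ?addr_ge0 ?(F0 _ e)// sumr_ge0// => k _.
  by rewrite !mulr_ge0 ?exprn_ge0 ?(F0 _ e).
have {}H : A / 2 * fine (P [set w | crowded w]) <=
    #|{: edge N}|%:R * ((2 * N)%:R * S).
  apply: le_trans (_ : \sum_(e : edge N) (2 * N)%:R * S <= _); last first.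
    by rewrite sumr_const -[X in X <= _]mulr_natl.
  apply: (le_trans (H _)) => [w|].
    have step_ge0 e f : 0 <= (A < `|Y e w|)%R%:R * dyadic_step a K `|Y f w|.
      by rewrite mulr_ge0 ?ler0n// dyadic_step_ge0// ltW.
    case: (boolP (crowded w)) => [/existsP[e /andP[eA]]|_]; last first.
      by rewrite mulr0; do 2 (apply: sumr_ge0 => ? _).
    rewrite mulr1 => le; rewrite (bigD1 e) //= -[leLHS]addr0 lerD//; last first.
      by do 2 (apply: sumr_ge0 => ? _).
    rewrite eA; under eq_bigr do rewrite mul1r.
    by apply: dyadic_step_sum_ge; rewrite ?ltW.
  apply: ler_sum => e _; rewrite sumr_const -[X in X <= _]mulr_natl.
  rewrite ler_wpM2r ?(S0 e)// ler_nat; apply: leq_trans (card_incident (val e).1).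
  by apply: subset_leq_card; apply/fintype.subsetP => f; rewrite !inE => /andP[].
rewrite -(ler_pM2l (divr_gt0 A0 (ltr0Sn R 1))); apply: le_trans H _.
rewrite le_eqVlt; apply/orP; left; apply/eqP; rewrite /A /S natrM.
have -> : \sum_(k < K) 2 ^+ k * (F K * F k) = F K * \sum_(k < K) 2 ^+ k * F k.
  by rewrite mulr_sumr; apply: eq_bigr => k _; rewrite mulrCA.
have : 2 ^+ K != 0 :> R by rewrite expf_neq0.
by move: (2 ^+ K) => q q0; field.
Qed.
End LocalField.

(** * The random enumeration and the Gibbs average at fixed size *)

Section Enumeration.
Context (R : realType) (N : nat).

Lemma measurable_decreasing_enum d (T : measurableType d)
    (J : edge N -> T -> R) u :
  (forall e, measurable_fun setT (J e)) ->
  measurable_fun setT (fun w => decreasing_enum (J ^~ w) u).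
Proof.
move=> mJ; rewrite /decreasing_enum.
apply: measurable_and; first exact: measurable_cst.
apply: measurable_and; first exact: measurable_cst.
apply: measurable_fun_forall => k; apply: measurable_fun_forall => l.
apply: measurable_fun_implyl; apply: measurable_fun_ler;
  by apply: measurableT_comp => //; exact: normr_measurable.
Qed.

(** The generated sigma-algebra is made into a measurable space, on which the
    J e are measurable by construction. *)
Lemma sigma_generated_decreasing d (T : measurableType d)
    (J : edge N -> T -> R) u :
  sigma_generated J [set w | ~~ decreasing_enum (J ^~ w) u].
Proof.
rewrite /sigma_generated; set G := [set B | _].
pose T' : measurableType _ := g_sigma_algebraType G.
apply: (@measurable_pred _ T' (fun w => ~~ decreasing_enum (J ^~ w) u)).
apply: measurable_neg; apply: (@measurable_decreasing_enum _ T') => e _ A mA.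
by rewrite setTI; apply: sub_gen_smallest; exists e, A.
Qed.

Context d (T : measurableType d) (P : probability T R) (J : edge N -> {RV P >-> R}).
Context (U : T -> enumeration N).
Hypothesis U_unif : uniform_decreasing_enum P (fun e => J e : T -> R) U.

Lemma measurable_enum_eq u : measurable_fun setT (fun w => U w == u).
Proof.
apply: (measurable_fun_bool true); rewrite setTI.
rewrite (_ : _ @^-1` _ = U @^-1` [set u]); first by case: (U_unif u).
by apply/seteqP; split=> w /= /eqP.
Qed.

Let misordered w := ~~ decreasing_enum (fun e => J e w) (U w).

Lemma measurable_misordered : measurable_fun setT misordered.
Proof.
rewrite (_ : misordered = fun w =>
  [forall u, (U w == u) ==> ~~ decreasing_enum (fun e => J e w) u]).
  apply: measurable_fun_forall => u.
  under eq_fun do rewrite implybE.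
  apply: measurable_or; first by apply: measurable_neg; exact: measurable_enum_eq.
  by apply: measurable_neg; apply: measurable_decreasing_enum.
apply/funext => w; apply/idP/forallP => [bw u|/(_ (U w))]; last by rewrite eqxx.
by apply/implyP => /eqP <-.
Qed.

(** The conditional law of U gives no mass to enumerations that are not
    decreasing: the event {U = u, u not decreasing} has as probability the
    integral of 0. *)
Lemma misordered_null : fine (P [set w | misordered w]) = 0.
Proof.
pose b u w := (U w == u) && ~~ decreasing_enum (fun e => J e w) u.
have mb u : measurable_fun setT (b u).
  apply: measurable_and; first exact: measurable_enum_eq.
  by apply: measurable_neg; apply: measurable_decreasing_enum.
have b0 u : fine (P [set w | b u w]) = 0.
  have Bu := @sigma_generated_decreasing _ _ (fun e => J e : T -> R) u.
  have [_ /(_ _ Bu) H] := U_unif u.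
  rewrite (_ : [set w | b u w] =
      [set w | ~~ decreasing_enum (fun e => J e w) u] `&` U @^-1` [set u]); last first.
    apply/seteqP; split=> w /=; first by move=> /andP[/eqP Uw dw]; split.
    by move=> [dw Uw]; apply/andP; split=> //; apply/eqP.
  rewrite H (_ : (\int[P]_(w in _) _)%E = (\int[P]_(w in
      [set w | ~~ decreasing_enum (fun e => J e w) u]) cst 0 w)%E).
    by rewrite integral0.
  by apply: eq_integral => w; rewrite inE /= => /negbTE ->; rewrite mul0r.
apply/eqP; rewrite eq_le fine_ge0 // andbT.
have -> : 0 = \sum_(u : enumeration N) fine (P [set w | b u w]).
  by rewrite big1.
apply: le_has_mean (has_mean_pred P measurable_misordered)
  (has_mean_sum (index_enum _) (fun u (_ : true) => has_mean_pred P (mb u))) _.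
move=> w; rewrite (bigD1 (U w)) //= /b eqxx /= -[leLHS]addr0 lerD//.
by rewrite sumr_ge0.
Qed.
End Enumeration.

Section GibbsMeasurability.
Context (R : realType) (N : nat) (beta r : R).
Context d (T : measurableType d) (P : probability T R) (J : edge N -> {RV P >-> R}).
Context (U : T -> enumeration N).

Let x w : edge N -> R := fun e => J e w.

Lemma measurable_bond s e : measurable_fun setT (fun w => bond (x w) s e).
Proof.
rewrite /bond; apply: measurable_funM; last exact: measurable_cst.
by apply: measurable_funM => //; exact: measurable_cst.
Qed.

Lemma measurable_gibbs s : measurable_fun setT (fun w => gibbs beta (x w) s).
Proof.
have mexp s' : measurable_fun setT (fun w => expR (neg_hamiltonian beta (x w) s')).
  apply: measurableT_comp; first exact: measurable_expR.
  apply: measurable_funM; first exact: measurable_cst.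
  by apply: measurable_sum => e; exact: measurable_bond.
rewrite /gibbs; apply: measurable_funM => //.
(* The inverse is a power with exponent -1, which is a measurable function. *)
under eq_fun do rewrite -powR_inv1 ?(ltW (partition_fun_gt0 _ _))//.
apply: (measurableT_comp (@measurable_powR R (-1))).
by apply: measurable_sum => s'; exact: mexp.
Qed.

Lemma measurable_gibbs_avg_all_chi :
  (forall u, measurable_fun setT (fun w => U w == u)) ->
  measurable_fun setT (fun w => gibbs_avg beta (x w) (all_chi (x w) (U w) r)).
Proof.
move=> mU; rewrite /gibbs_avg; apply: measurable_sum => s; apply: measurable_funM.
  exact: measurable_gibbs.
apply: measurable_fun_natb.
pose b w (k : 'I_(num_edges N)) :=
  [forall u, (U w == u) ==> (k.+1%:R <= r) ==> (0 < bond (x w) s (u k))].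
rewrite (_ : (fun w => _) = (fun w => [forall k, b w k])).
  apply: measurable_fun_forall => k; apply: measurable_fun_forall => u.
  under eq_fun do rewrite implybE.
  apply: measurable_or; first exact: measurable_neg.
  apply: measurable_fun_implyl.
  apply: measurable_fun_ltr; first exact: measurable_cst.
  exact: measurable_bond.
apply/funext => w; apply: eq_forallb => k; rewrite chi_eq1.
apply/idP/forallP => [H u|/(_ (U w))]; last by rewrite eqxx sgr_cp0.
by apply/implyP => /eqP <-; rewrite -sgr_cp0.
Qed.
End GibbsMeasurability.

Section FixedSize.
Context (R : realType) (N : nat) (beta r a : R) (F : nat -> R) (K : nat).
Context d (T : measurableType d) (P : probability T R) (J : edge N -> {RV P >-> R}).
Context (U : T -> enumeration N).

(** The three error terms are: too few bonds above the level a 2^K; a bond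
    above that level with a large local field; the Gibbs probability that one
    of the top r bonds is violated although neither happens. *)
Lemma gibbs_expectation_bounds :
  0 <= beta -> 0 <= r -> 0 < a ->
  mutually_independent P (fun e => J e : T -> R) ->
  (forall e k, fine (P [set w | a * 2 ^+ k < `|J e w|]) = F k) ->
  uniform_decreasing_enum P (fun e => J e : T -> R) U ->
  let n := #|{: edge N}|%:R in
  let m := n * F K in
  0 < m -> r <= m / 2 ->
  exists2 v : R,
    'E_P[fun w => gibbs_avg beta (fun e => J e w)
                 (all_chi (fun e => J e w) (U w) r)]%E = v%:E &
    1 - (4 / m + 4 * n * N%:R * F K * (1 + \sum_(k < K) 2 ^+ k * F k) / 2 ^+ K
         + r * expR (- (beta * (a * 2 ^+ K)))) <= v <= 1.
Proof.
move=> beta0 r0 a0 indep tailJ U_unif n m m0 rm.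
pose f w := gibbs_avg beta (fun e => J e w) (all_chi (fun e => J e w) (U w) r).
set A := a * 2 ^+ K.
have mU := measurable_enum_eq U_unif.
have mf : measurable_fun setT f by exact: measurable_gibbs_avg_all_chi.
have f01 w : 0 <= f w <= 1 by exact: gibbs_avg_all_chi_itv.
have [v fv] := has_mean_bounded P mf f01.
exists v; first by rewrite unlock; case: fv.
have v1 : v <= 1.
  by apply: le_has_mean fv (has_mean_cst P ler01) _ => w; case/andP: (f01 w).
rewrite v1 andbT.
have mexc e := measurable_exceeds J e A.
have mfew : measurable_fun setT (fun w => #|[pred e | A < `|J e w|]|%:R <= m / 2).
  by apply: measurable_fun_ler; [exact: measurable_card|exact: measurable_cst].
have cheb := @chebyshev_count _ _ _ P _ (fun e w => A < `|J e w|) (F K) mexc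
  (fun e => tailJ e K)
  (fun e f => @tail_pair _ _ _ _ _ _ _ _ indep tailJ e f K K) m0.
have sum_le := le_has_mean (has_mean_cst P ler01)
  (has_meanD (has_meanD (has_meanD fv
     (has_mean_cst P (mulr_ge0 r0 (expR_ge0 (- (beta * A))))))
     (has_meanD (has_mean_pred P mfew)
        (has_mean_pred P (measurable_crowded J a K))))
     (has_mean_pred P (measurable_misordered U_unif))).
have crowd := crowded_le K indep a0 tailJ.
rewrite (misordered_null U_unif) in sum_le.
(* The constant 1 is at most the Gibbs average plus its error, plus the
   indicators of the three exceptional events; taking means concludes. *)
suff /sum_le : forall w, cst 1 w <= f w + cst (r * expR (- (beta * A))) w +
    ((#|[pred e | A < `|J e w|]|%:R <= m / 2)%R%:R + (crowded J a K w)%:R) +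
    (~~ decreasing_enum (fun e => J e w) (U w))%:R.
  move: crowd cheb; rewrite -/n -/m -/A; lra.
move=> w; have /andP[f0 _] := f01 w.
have e0 : 0 <= r * expR (- (beta * A)) by rewrite mulr_ge0 ?expR_ge0.
case: (boolP (decreasing_enum _ _)) => [dec|_]; last first.
  by rewrite /= lerDr !addr_ge0 ?ler0n.
case: (boolP (crowded J a K w)) => [_|calm].
  by rewrite /= addr0 addrA lerDr !addr_ge0 ?ler0n.
have [_|many] := boolP (_ <= m / 2).
  by rewrite /= !addr0 lerDr !addr_ge0.
rewrite /= !addr0 -lerBlDr; apply: gibbs_avg_all_chi_ge => //.
  by rewrite mulr_gt0// exprn_gt0.
apply/andP; split.
  by apply: le_trans rm _; rewrite ltW// ltNge.
apply/forallP => e; apply/implyP => Ae; rewrite leNgt.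
by move: calm; rewrite negb_exists => /forallP/(_ e); rewrite -/A Ae.
Qed.
End FixedSize.

(** * Dyadic tails and the scaling constant *)

Section RegularVariation.
Context {R : realType}.

(** Slow variation with ratio 2 says that G (2 x) / G x tends to 2^(- alpha);
    x0 is any point beyond which the ratio stays between q' and q. *)
Lemma tail_doubling (alpha q q' : R) (L G : R -> R) :
  (forall x, 0 < x -> 0 < L x) -> slowly_varying L ->
  (forall x, 0 < x -> G x = L x / x `^ alpha) ->
  q' < 2 `^ (- alpha) < q ->
  exists2 x0 : R, 0 < x0 & forall k,
    q' * G (x0 * 2 ^+ k) <= G (x0 * 2 ^+ k.+1) <= q * G (x0 * 2 ^+ k).
Proof.
move=> L0 slow GE /andP[q'lt ltq].
have lim : L (2 * x) / L x * 2 `^ (- alpha) @[x --> +oo] --> (2 `^ (- alpha) : R).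
  rewrite -[X in _ --> X]mul1r; apply: cvgMl; exact: slow.
have [M [_ HM]] := filterI (cvgr_lt _ lim _ ltq) (cvgr_gt _ lim _ q'lt).
have x0gt0 : 0 < Num.max M 0 + 1 by rewrite ltr_wpDl// le_max lexx orbT.
exists (Num.max M 0 + 1) => // k.
set x0 := Num.max M 0 + 1 in x0gt0 *.
set x := x0 * 2 ^+ k.
have xx0 : x0 <= x by rewrite ler_peMr ?(ltW x0gt0)// exprn_ege1// ler1n.
have Mx : M < x by apply: lt_le_trans xx0; rewrite ltr_pwDr// le_max lexx.
have x_gt0 : 0 < x := lt_le_trans x0gt0 xx0.
have [/= ub lb] := HM _ Mx.
have Gx0 : 0 < G x by rewrite GE// divr_gt0 ?L0 ?powR_gt0.
have -> : G (x0 * 2 ^+ k.+1) = L (2 * x) / L x * 2 `^ (- alpha) * G x.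
  rewrite exprSr [x0 * _]mulrA -/x [x * 2]mulrC !GE ?mulr_gt0//.
  rewrite powRM ?(ltW x_gt0)// powRN invfM.
  by field; rewrite !gt_eqF ?L0 ?powR_gt0.
by rewrite !ler_wpM2r ?ltW.
Qed.

Lemma geometric_tail (q q' : R) (f : nat -> R) (k : nat) :
  0 < q' -> 0 < q -> (forall k, q' * f k <= f k.+1 <= q * f k) ->
  q' ^+ k * f 0%N <= f k <= q ^+ k * f 0%N.
Proof.
move=> q'0 q0 fq; elim: k => [|k /andP[lb ub]]; first by rewrite !expr0 !mul1r lexx.
have /andP[lbk ubk] := fq k; apply/andP; split.
  by apply: le_trans lbk; rewrite exprS -mulrA ler_wpM2l// ltW.
by apply: le_trans ubk _; rewrite exprS -mulrA ler_wpM2l// ltW.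
Qed.

(** The sum is the truncated mean of a variable with tail at most f 0 q^k at
    2^k: since 2 q > 1, it is governed by its last term.  This is where a tail
    exponent less than 1 is essential. *)
Lemma dyadic_mean_le (q : R) (f : nat -> R) (K : nat) :
  1 < 2 * q -> 0 <= f 0%N -> (forall k, f k <= q ^+ k * f 0%N) ->
  1 + \sum_(k < K) 2 ^+ k * f k <= (1 + f 0%N / (2 * q - 1)) * (2 * q) ^+ K.
Proof.
move=> q1 f0 fq; have q10 : 0 < 2 * q - 1 by rewrite subr_gt0.
have S : \sum_(k < K) 2 ^+ k * f k <= f 0%N / (2 * q - 1) * ((2 * q) ^+ K - 1).
  rewrite subrX1 -mulrA mulKf ?gt_eqF// mulr_sumr; apply: ler_sum => k _.
  by rewrite exprMn mulrCA ler_wpM2l ?exprn_ge0// mulrC.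
have Q1 : 1 <= (2 * q) ^+ K by rewrite exprn_ege1// ltW.
have c0 : 0 <= f 0%N / (2 * q - 1) by rewrite divr_ge0// ltW.
move: (f 0%N / _) ((2 * q) ^+ K) (\sum_(k < K) _) S Q1 c0 => c Q S SL Q1 c0; nra.
Qed.
End RegularVariation.

Section Scaling.
Context (R : realType) d (T : measurableType d) (P : probability T R).
Context (X : {RV P >-> R}) (G : R -> R) (N : nat).
Hypothesis tailX : forall x, 0 < x -> P [set w | x < `|X w|] = (G x)%:E.

Lemma tail_decreasing x y : 0 < x -> x <= y -> G y <= G x.
Proof.
move=> x0 xy; rewrite -lee_fin -!tailX ?(lt_le_trans x0)//.
have mX t : measurable [set w | t < `|X w|].
  by apply: measurable_pred; exact: measurable_lt_norm.
by apply: le_measure; rewrite ?inE// => w /=; exact: le_lt_trans.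
Qed.

Lemma scaling_le y : 0 < y -> N%:R * G y <= 1 -> scaling P X N <= y.
Proof.
move=> y0 Gy; apply: ge_inf; first by exists 0 => x [/ltW].
by split=> //; rewrite tailX// -EFinM lee_fin.
Qed.

(** For small N the infimum may be 0; an explicit z > 0 whose tail is more
    than 1 / N keeps it away from 0. *)
Lemma scaling_ge y z : 0 < y -> N%:R * G y <= 1 ->
  0 < z -> 1 < N%:R * G z -> z <= scaling P X N.
Proof.
move=> y0 Gy z0 Gz; apply: lb_le_inf.
  by exists y; split=> //; rewrite tailX// -EFinM lee_fin.
move=> x [x0]; rewrite tailX// -EFinM lee_fin => Gx; rewrite leNgt; apply/negP => xz.
have : G z <= G x by apply: tail_decreasing => //; exact: ltW.
move=> /(ler_wpM2l (ler0n R N)) H.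
by move: (lt_le_trans Gz (le_trans H Gx)); rewrite ltxx.
Qed.

Lemma eq_law_tail d' (T' : measurableType d') (P' : probability T' R)
    (Y : T' -> R) (b t : R) : 0 < b -> 0 < t ->
  eq_law P' P Y (fun w => b^-1 * X w) ->
  fine (P' [set w | t / b < `|Y w|]) = G t.
Proof.
move=> b0 t0 law.
have mB : measurable [set x : R | t / b < `|x|].
  exact: (measurable_pred (measurable_lt_norm _ (@measurable_id _ R setT))).
have := law _ mB; rewrite [X in X = _](_ : _ = P' [set w | t / b < `|Y w|])// => ->.
rewrite (_ : _ @^-1` _ = [set w | t < `|X w|]) ?tailX//.
apply/seteqP; split=> w /=;
  by rewrite normrM gtr0_norm ?invr_gt0// mulrC ltr_pM2l ?invr_gt0.
Qed.
End Scaling.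

Lemma num_edges2 N : (num_edges N * 2 = N * (N - 1))%N.
Proof.
rewrite /num_edges divnK// dvdn2 oddM; case: N => // N.
by rewrite subn1 /= andNb.
Qed.

Lemma dyadic_floor (R : realType) (y : R) : 1 <= y ->
  exists K : nat, 2 ^+ K <= y < 2 ^+ K.+1.
Proof.
move=> y1; have y0 : 0 <= y := le_trans ler01 y1.
have t0 : (0 < Num.truncn y)%N by rewrite truncn_gt0.
have /andP[lb ub] := trunc_log_bounds (isT : 1 < 2)%N t0.
exists (trunc_log 2 (Num.truncn y)); rewrite -!natrX; apply/andP; split.
  by rewrite -truncn_ge_nat.
by rewrite -truncn_lt_nat.
Qed.

(** * The choice of the level *)

Lemma gt1_ltr_powR (R : realType) (a x y : R) : 1 < a -> x < y -> a `^ x < a `^ y.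
Proof.
move=> a1 xy; rewrite /powR gt_eqF ?(lt_trans ltr01)//.
by rewrite ltr_expR ltr_pM2r// ln_gt0.
Qed.

Section Scale.
Context {R : realType}.
Variables (alpha delta : R).
Hypothesis alpha01 : 0 < alpha < 1.
Hypothesis delta0 : 0 < delta < 1 / 2.

(** The ratios q and q' are 2^(- s) for tail exponents s slightly below and
    slightly above alpha. *)
Let q : R := 2 `^ (- (alpha * (1 - delta / 8))).
Let q' : R := 2 `^ (- (alpha * (1 + delta / 8))).

Lemma powR_exprn (s : R) (K : nat) : (2 `^ (- s)) ^+ K = ((2 ^+ K) `^ s)^-1.
Proof.
by rewrite -powR_mulrn ?powR_ge0// powRAC powR_mulrn ?ler0n// powRN.
Qed.

Lemma ratios_bracket : q' < 2 `^ (- alpha) < q.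
Proof.
have /andP[a0 a1] := alpha01; have /andP[d0 d1] := delta0.
by apply/andP; split; apply: gt1_ltr_powR; rewrite ?ltr1n//; nra.
Qed.

Lemma upper_ratio_gt : 1 < 2 * q.
Proof.
rewrite -[X in X * q](@powRr1 R 2)// -powRD; last by rewrite pnatr_eq0 implybT.
have /andP[a0 a1] := alpha01; have /andP[d0 d1] := delta0.
by rewrite -[ltLHS](powRr0 2); apply: gt1_ltr_powR; rewrite ?ltr1n//; nra.
Qed.

Lemma upper_ratio_le1 : q <= 1.
Proof.
have /andP[a0 a1] := alpha01; have /andP[d0 d1] := delta0.
by rewrite -[leRHS](powRr0 2) ler_powR ?ler1n//; nra.
Qed.

(** The power 2^K is taken just below X^theta with
    theta alpha = 3 / 2 + delta / 2.  At that level q'^K and q^K are between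
    X^(- 3 / 2 - 3 delta / 4) and 2 X^(- 3 / 2 - delta / 8): the relative margin
    delta / 8 in the two tail exponents is small enough for the lower bound to
    beat X^(kappa - 2) when kappa <= 1 / 2 - delta, and for X^3 times the square
    of the upper bound to be O(X^(- delta / 4)). *)
Lemma dyadic_scale (X : R) : 1 <= X -> exists K : nat,
  [/\ X ^+ 3 * (q ^+ K) ^+ 2 <= 4 * X `^ (- (delta / 4)),
      X `^ (- (3 / 2 + 3 * delta / 4)) <= q' ^+ K &
      X `^ (3 / 2) <= 2 ^+ K.+1].
Proof.
move=> X1; have X0 : 0 < X := lt_le_trans ltr01 X1.
have Xn0 e1 e2 : (e1 + e2 == 0) ==> (X != 0) by rewrite gt_eqF// implybT.
have /andP[a0 a1] := alpha01; have /andP[d0 d1] := delta0.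
set theta := (3 / 2 + delta / 2) / alpha.
have thetaa : theta * alpha = 3 / 2 + delta / 2 by rewrite mulfVK// gt_eqF.
have theta32 : 3 / 2 <= theta.
  by rewrite ler_pdivlMr//; nra.
have [K /andP[lb ub]] : exists K : nat, 2 ^+ K <= X `^ theta < 2 ^+ K.+1.
  by apply: dyadic_floor; rewrite -[leLHS](powRr0 X) ler_powR//; lra.
have K0 : 0 < 2 ^+ K :> R by rewrite exprn_gt0.
exists K; split.
- rewrite /q powR_exprn; set s := alpha * _.
  have s0 : 0 <= s by rewrite /s; nra.
  have s1 : s <= 1 by rewrite /s; nra.
  have ths : theta * s = (3 / 2 + delta / 2) * (1 - delta / 8) by rewrite mulrA thetaa.
  clearbody s.
  have H : X `^ (theta * s) <= 2 * (2 ^+ K) `^ s.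
    rewrite powRrM; apply: (@le_trans _ _ ((2 * 2 ^+ K) `^ s)).
      apply: ge0_ler_powR; rewrite ?nnegrE ?powR_ge0 ?mulr_ge0 ?(ltW K0)//.
      by rewrite -exprS ltW.
    rewrite powRM ?(ltW K0)// ler_wpM2r ?powR_ge0// -[leRHS](@powRr1 R 2)//.
    by rewrite ler_powR ?ler1n.
  have H2 : ((2 ^+ K) `^ s)^-1 <= 2 * X `^ (- (theta * s)).
    by rewrite powRN ler_pdivlMr ?powR_gt0// mulrC ler_pdivrMr ?powR_gt0.
  apply: (@le_trans _ _ (X ^+ 3 * (2 * X `^ (- (theta * s))) ^+ 2)).
    rewrite ler_wpM2l ?exprn_ge0 ?(ltW X0)//.
    by rewrite lerXn2r ?nnegrE ?invr_ge0 ?mulr_ge0 ?powR_ge0.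
  rewrite exprMn mulrCA -natrX -[X ^+ 3]powR_mulrn ?(ltW X0)//.
  rewrite -[X in _ * (_ * X)]powR_mulrn ?powR_ge0// -powRrM -powRD ?Xn0//.
  rewrite ler_wpM2l// ler_powR// ths; nra.
- rewrite /q' powR_exprn.
  rewrite powRN lef_pV2 ?posrE ?powR_gt0//.
  apply: (@le_trans _ _ ((X `^ theta) `^ (alpha * (1 + delta / 8)))).
    apply: ge0_ler_powR; rewrite ?nnegrE ?powR_ge0 ?(ltW K0)//; nra.
  by rewrite -powRrM ler_powR// mulrA thetaa; nra.
- by apply: le_trans (ltW ub); rewrite ler_powR.
Qed.
End Scale.

Lemma expR_cube_le (R : realType) (x : R) : 0 < x -> expR (- x) <= 6 / x ^+ 3.
Proof.
move=> x0; have x3 : 0 < x ^+ 3 by rewrite exprn_gt0.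
have := expR_ge1Dxn 2 (ltW x0); rewrite -[3`!]/6%N => H.
rewrite expRN -[leRHS]invf_div lef_pV2 ?posrE ?expR_gt0 ?divr_gt0//.
by apply: le_trans H; rewrite lerDr.
Qed.

(** The rounding in K %/ 3 costs at most 2 in 3 (K %/ 3), and the exponent
    K + 1 on the left one more: hence the factor 8. *)
Lemma dyadic_third (R : realType) (K : nat) :
  2 ^+ K.+1 / 8 <= (2 ^+ (K %/ 3)) ^+ 3 :> R.
Proof.
rewrite ler_pdivrMr// -exprM -[8%:R]/((2 ^ 3)%:R) natrX -exprD ler_eXn2l ?ltr1n//.
have := ltn_pmod K (isT : 0 < 3)%N; have := divn_eq K 3; lia.
Qed.

Lemma card_edge_bounds (R : realType) (N : nat) : (2 <= N)%N ->
  (N%:R ^+ 2 / 4 <= #|{: edge N}|%:R :> R) && (#|{: edge N}|%:R <= N%:R ^+ 2 :> R).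
Proof.
move=> N2; rewrite card_edge.
have : (num_edges N * 2)%:R = (N * (N - 1))%:R :> R by rewrite num_edges2.
have {N2} : (2 : R) <= N%:R by rewrite ler_nat.
case: N => [|N]; first by rewrite ler_nat.
by rewrite subn1 !natrM -natr1 => N2 nE; apply/andP; split; nra.
Qed.

Lemma leq_two_thirds (K : nat) : (K * 2 <= (K - K %/ 3) * 3)%N.
Proof. by have := leq_divM K 3; rewrite mulnBl; lia. Qed.

(** All three error terms are O(X^(- delta / 4)) at the level 2^K of
    dyadic_scale.  The integer M = K - K %/ 3 serves to compare this level with
    the scaling constant: X f M <= 1 means that the latter is at most of order
    2^M, since (X q^M)^3 <= X^3 q^(2 K) is small.  In units of the scaling
    constant the level A is therefore at least 2^(K %/ 3), whose cube dominates
    X^(3 / 2), and exp (- x) <= 6 / x^3 suffices for the Gibbs error. *)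
Lemma error_bound (R : realType) (alpha delta beta kappa : R) (f : nat -> R) :
  let q : R := 2 `^ (- (alpha * (1 - delta / 8))) in
  let q' : R := 2 `^ (- (alpha * (1 + delta / 8))) in
  let C := 16 / f 0%N + 16 * f 0%N * (1 + f 0%N / (2 * q - 1)) + 48 / beta ^+ 3 in
  0 < alpha < 1 -> 0 < delta < 1 / 2 -> 0 < beta -> kappa <= 1 / 2 - delta ->
  0 < f 0%N -> (forall k, q' * f k <= f k.+1 <= q * f k) ->
  forall X n rho : R, 1 <= X -> X ^+ 2 / 4 <= n <= X ^+ 2 ->
  rho = X `^ (- (delta / 4)) -> rho <= f 0%N / 8 -> 4 * f 0%N ^+ 3 * rho <= 1 ->
  exists K M : nat, [/\ X * f M <= 1, 0 < n * f K, X `^ kappa <= n * f K / 2 &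
    forall A, 2 ^+ K <= A * 2 ^+ M ->
      4 / (n * f K) + 4 * n * X * f K * (1 + \sum_(k < K) 2 ^+ k * f k) / 2 ^+ K
        + X `^ kappa * expR (- (beta * A)) <= C * rho].
Proof.
move=> q q' C a01 d01 b0 kd f0 fq X n rho X1 /andP[nlb nub] rhoE rho1 rho2.
have X0 : 0 < X := lt_le_trans ltr01 X1.
have rho0 : 0 < rho by rewrite rhoE powR_gt0.
have q0 : 0 < q by rewrite powR_gt0.
have q'0 : 0 < q' by rewrite powR_gt0.
have fgeo k := geometric_tail k q'0 q0 fq.
have q1 := upper_ratio_gt a01 d01; rewrite -/q in q1.
have qle1 := upper_ratio_le1 a01 d01; rewrite -/q in qle1.
have [K [QK q'K KX]] := dyadic_scale a01 d01 X1.
rewrite -/q -/q' -rhoE in QK q'K.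
have Xn0 e1 e2 : (e1 + e2 == 0) ==> (X != 0) by rewrite gt_eqF// implybT.
have /andP[d0 d1] := d01.
have n0 : 0 < n by apply: lt_le_trans nlb; rewrite divr_gt0// exprn_gt0.
have fK0 k : 0 < f k.
  by have /andP[+ _] := fgeo k; apply: lt_le_trans; rewrite mulr_gt0// exprn_gt0.
have mlb : f 0%N / 4 * X `^ (1 / 2 - 3 * delta / 4) <= n * f K.
  have -> : 1 / 2 - 3 * delta / 4 = 2 - (3 / 2 + 3 * delta / 4) by field.
  rewrite powRD ?Xn0// powR_mulrn ?(ltW X0)//.
  have /andP[fl _] := fgeo K.
  have h1 : f 0%N * X `^ (- (3 / 2 + 3 * delta / 4)) <= f K.
    by apply: le_trans fl; rewrite mulrC ler_wpM2r// ltW.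
  have h2 : 0 <= X ^+ 2 / 4 by rewrite divr_ge0 ?exprn_ge0 ?(ltW X0).
  have h3 : 0 <= f 0%N * X `^ (- (3 / 2 + 3 * delta / 4)).
    by rewrite mulr_ge0 ?powR_ge0 ?(ltW f0).
  have := ler_pM h2 h3 nlb h1.
  by apply: le_trans; rewrite le_eqVlt; apply/orP; left; apply/eqP; ring.
exists K, (K - K %/ 3)%N; set M := (K - K %/ 3)%N.
have M23 : (K * 2 <= M * 3)%N := leq_two_thirds K.
split.
- have /andP[_ fu] := fgeo M.
  apply: (@le_trans _ _ (X * (q ^+ M * f 0%N))); first by rewrite ler_wpM2l// ltW.
  rewrite -(@ler_pXn2r _ 3) ?nnegrE//; last first.
    by rewrite !mulr_ge0 ?exprn_ge0 ?(ltW X0) ?(ltW q0) ?(ltW f0).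
  rewrite expr1n.
  have XqM : X ^+ 3 * (q ^+ M) ^+ 3 <= 4 * rho.
    apply: le_trans QK; rewrite ler_wpM2l ?exprn_ge0 ?(ltW X0)//.
    by rewrite -!exprM ler_wiXn2l// ltW.
  have -> : (X * (q ^+ M * f 0%N)) ^+ 3 = f 0%N ^+ 3 * (X ^+ 3 * (q ^+ M) ^+ 3).
    by rewrite !exprMn; ring.
  apply: le_trans rho2; rewrite [leRHS]mulrAC mulrC ler_wpM2r ?exprn_ge0 ?(ltW f0)//.
- by rewrite mulr_gt0.
- apply: (@le_trans _ _ (X `^ (1 / 2 - delta))); first by rewrite ler_powR.
  rewrite ler_pdivlMr//; apply: le_trans mlb.
  have -> : 1 / 2 - delta = - (delta / 4) + (1 / 2 - 3 * delta / 4) by field.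
  rewrite powRD ?Xn0// -rhoE mulrAC ler_wpM2r ?powR_ge0//; lra.
move=> A AM.
have t1 : 4 / (n * f K) <= 16 / f 0%N * rho.
  apply: (@le_trans _ _ (4 / (f 0%N / 4 * X `^ (1 / 2 - 3 * delta / 4)))).
    by rewrite ler_wpM2l// lef_pV2 ?posrE ?mulr_gt0 ?divr_gt0 ?powR_gt0.
  have -> : 4 / (f 0%N / 4 * X `^ (1 / 2 - 3 * delta / 4)) =
      16 / f 0%N * X `^ (- (1 / 2 - 3 * delta / 4)).
    by rewrite powRN; field; rewrite !gt_eqF ?powR_gt0.
  rewrite ler_wpM2l ?divr_ge0 ?(ltW f0)// rhoE ler_powR//; lra.
have t2 : 4 * n * X * f K * (1 + \sum_(k < K) 2 ^+ k * f k) / 2 ^+ K <=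
    16 * f 0%N * (1 + f 0%N / (2 * q - 1)) * rho.
  have fub k : f k <= q ^+ k * f 0%N by case/andP: (fgeo k).
  have S := dyadic_mean_le K q1 (ltW f0) fub.
  set c := 1 + f 0%N / _ in S *.
  have c0 : 0 <= c by rewrite addr_ge0// divr_ge0 ?(ltW f0)// subr_ge0 ltW.
  rewrite ler_pdivrMr ?exprn_gt0//.
  apply: (@le_trans _ _ (4 * X ^+ 2 * X * (q ^+ K * f 0%N) * (c * (2 * q) ^+ K))).
    apply: ler_pM; last exact: S.
    - by rewrite !mulr_ge0 ?ltW.
    - by rewrite addr_ge0// sumr_ge0// => k _; rewrite mulr_ge0 ?exprn_ge0 ?ltW.
    - apply: ler_pM; last exact: fub.
      + by rewrite !mulr_ge0 ?ltW.
      + exact: ltW.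
      + by rewrite ler_wpM2r ?(ltW X0)// ler_wpM2l.
  rewrite exprMn.
  have -> : 4 * X ^+ 2 * X * (q ^+ K * f 0%N) * (c * (2 ^+ K * q ^+ K)) =
     (4 * f 0%N * c * 2 ^+ K) * (X ^+ 3 * (q ^+ K) ^+ 2) by ring.
  have -> : 16 * f 0%N * c * rho * 2 ^+ K =
      (4 * f 0%N * c * 2 ^+ K) * (4 * rho) by ring.
  by rewrite ler_wpM2l// !mulr_ge0 ?exprn_ge0 ?(ltW f0).
have t3 : X `^ kappa * expR (- (beta * A)) <= 48 / beta ^+ 3 * rho.
  have A2 : 2 ^+ (K %/ 3) <= A.
    rewrite -(@ler_pM2r _ (2 ^+ M)) ?exprn_gt0//; apply: le_trans AM.
    by rewrite -exprD subnKC// leq_div.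
  have A0 : 0 < A by apply: lt_le_trans A2; rewrite exprn_gt0.
  have A3 : X `^ (3 / 2) / 8 <= A ^+ 3.
    apply: (@le_trans _ _ ((2 ^+ (K %/ 3)) ^+ 3)).
      by apply: le_trans _ (dyadic_third R K); rewrite ler_pM2r// invr_gt0.
    by rewrite lerXn2r ?nnegrE ?exprn_ge0 ?(ltW A0).
  have e1 := expR_cube_le (mulr_gt0 b0 A0).
  have e2 : expR (- (beta * A)) <= 48 / beta ^+ 3 * X `^ (- (3 / 2)).
    apply: le_trans e1 _; rewrite exprMn powRN.
    rewrite ler_pdivrMr ?mulr_gt0 ?exprn_gt0//.
    have b3 : 0 < beta ^+ 3 by rewrite exprn_gt0.
    have p3 : 0 < X `^ (3 / 2) by rewrite powR_gt0.
    have -> : 48 / beta ^+ 3 / X `^ (3 / 2) * (beta ^+ 3 * A ^+ 3) =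
       48 * A ^+ 3 / X `^ (3 / 2) by field; rewrite ?gt_eqF.
    by rewrite ler_pdivlMr//; lra.
  apply: (@le_trans _ _ (X `^ (1 / 2) * (48 / beta ^+ 3 * X `^ (- (3 / 2))))).
    rewrite ler_pM ?powR_ge0 ?expR_ge0// ler_powR//; lra.
  rewrite mulrCA -powRD ?Xn0// ler_wpM2l ?divr_ge0 ?exprn_ge0 ?(ltW b0)//.
  rewrite rhoE ler_powR//; lra.
by rewrite /C [leRHS]mulrDl [X in _ <= X + _]mulrDl; exact: lerD (lerD t1 t2) t3.
Qed.

(** * The limit *)

Lemma cvg_natr_powRN (R : realType) (c : R) : 0 < c ->
  (fun N : nat => (N%:R : R) `^ (- c)) @ \oo --> (0 : R).
Proof.
move=> c0; apply/cvgr0Pnorm_le => e e0.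
near=> N.
have N0 : 0 < N%:R :> R by rewrite ltr0n; near: N; exact: nbhs_infty_gt.
have eN : (e^-1) `^ c^-1 <= N%:R by near: N; exact: nbhs_infty_ger.
rewrite ger0_norm ?powR_ge0// powRN invf_ple ?posrE ?powR_gt0//.
have -> : e^-1 = (e^-1 `^ c^-1) `^ c.
  by rewrite -powRrM mulVf ?gt_eqF// powRr1// invr_ge0 ltW.
by apply: ge0_ler_powR; rewrite ?nnegrE ?powR_ge0 ?ler0n// ltW.
Unshelve. all: by end_near. Qed.

Theorem theorem2p12 (R : realType) (alpha beta delta : R)
  (* the variable X and its tail *)
  (d0 : measure_display) (T0 : measurableType d0) (P0 : probability T0 R)
  (X : {RV P0 >-> R}) (L : R -> R)
  (* for each N, a probability space carrying the disorder J_e, e = (i, j)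
     with i < j, and the random enumeration U of the pairs *)
  (d : nat -> measure_display) (T : forall N : nat, measurableType (d N))
  (P : forall N : nat, probability (T N) R)
  (J : forall N : nat, edge N -> {RV (P N) >-> R})
  (U : forall N : nat, T N -> enumeration N) :
  0 < alpha < 1 -> 0 < beta ->
  0 < delta < Num.min (1 / 2) (1 - alpha) ->
  symmetric_law P0 X ->
  (forall x : R, 0 < x -> 0 < L x) ->
  slowly_varying L ->
  (forall x : R, 0 < x ->
    P0 [set w | x < `|X w|] = (L x / x `^ alpha)%:E) ->
  (forall (N : nat) (e : edge N),
    eq_law (P N) P0 (J N e) (fun w => (scaling P0 X N)^-1 * X w)) ->
  (forall N : nat, mutually_independent (P N) (fun e => J N e : T N -> R)) ->
  (forall N : nat,
    uniform_decreasing_enum (P N) (fun e => J N e : T N -> R) (U N)) ->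
  let kappa : R := Num.min (1 / 2) (1 - alpha) - delta in
  (fun N : nat =>
     'E_(P N) [fun w => gibbs_avg beta (fun e => J N e w)
                 (all_chi (fun e => J N e w) (U N w) (N%:R `^ kappa))])%E
    @ \oo --> (1%:E : \bar R).
Proof.
move=> /andP[al0 al1] b0 /andP[de0 dmin] _ L0 slow tail law indep unif kappa.
have d12 : delta < 1 / 2 by apply: lt_le_trans dmin _; rewrite ge_min lexx.
have kd : kappa <= 1 / 2 - delta by rewrite lerD2r ge_min lexx.
have a01 : 0 < alpha < 1 by rewrite al0.
have d01 : 0 < delta < 1 / 2 by rewrite de0.
pose G x := L x / x `^ alpha.
have [x0 x0_gt0 dbl] := tail_doubling L0 slow (fun x _ => erefl (G x))
  (ratios_bracket a01 d01).
pose f k := G (x0 * 2 ^+ k).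
have pow2 k : 0 < x0 * 2 ^+ k by rewrite mulr_gt0// exprn_gt0.
have G_gt0 x : 0 < x -> 0 < G x by move=> x1; rewrite divr_gt0 ?L0 ?powR_gt0.
have f0 : 0 < f 0%N by exact: G_gt0 (pow2 0%N).
have f3 : 0 < 4 * f 0%N ^+ 3 := mulr_gt0 (ltr0Sn R 3) (exprn_gt0 3 f0).
have G1 : 0 < G 1 by exact: G_gt0.
have [C main] : exists C : R, \forall N \near \oo, exists2 v : R,
    'E_(P N)[fun w => gibbs_avg beta (fun e => J N e w)
       (all_chi (fun e => J N e w) (U N w) (N%:R `^ kappa))]%E = v%:E &
    1 - C * N%:R `^ (- (delta / 4)) <= v <= 1.
  have EB := error_bound a01 d01 b0 kd f0 dbl.
  have rho0 := cvg_natr_powRN (divr_gt0 de0 (ltr0Sn R 3)).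
  eexists; near=> N.
  have N2 : (2 <= N)%N by near: N; exact: nbhs_infty_ge.
  have N1 : 1 <= N%:R :> R by rewrite ler1n (leq_trans _ N2).
  have rho1 : N%:R `^ (- (delta / 4)) <= f 0%N / 8.
    near: N; apply: (cvgr_le 0) => //; exact: divr_gt0 f0 (ltr0Sn R 7).
  have rho2 : 4 * f 0%N ^+ 3 * N%:R `^ (- (delta / 4)) <= 1.
    rewrite mulrC -ler_pdivlMr; last exact: f3.
    near: N; apply: (cvgr_le 0) => //; exact: divr_gt0 ltr01 f3.
  have NG : 1 < N%:R * G 1.
    by rewrite -ltr_pdivrMr//; near: N; exact: nbhs_infty_gtr.
  have [K [M [NM m0 rm err]]] :=
    EB N%:R #|{: edge N}|%:R _ N1 (card_edge_bounds R N2) erefl rho1 rho2.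
  have tailG x : 0 < x -> P0 [set w | x < `|X w|] = (G x)%:E by move=> /tail.
  have sM := scaling_le tailG (pow2 M) NM.
  have s1 := scaling_ge tailG (pow2 M) NM ltr01 NG.
  have s0 := lt_le_trans ltr01 s1.
  set b := scaling P0 X N in sM s1 s0.
  have tailJ e k : fine (P N [set w | x0 / b * 2 ^+ k < `|J N e w|]) = f k.
    rewrite mulrAC; exact: (eq_law_tail tailG s0 (pow2 k) (law N e)).
  have [v Ev /andP[lb ub]] := gibbs_expectation_bounds (ltW b0) (powR_ge0 _ kappa)
    (divr_gt0 x0_gt0 s0) (indep N) tailJ (unif N) m0 rm.
  exists v => //; rewrite ub andbT; apply: le_trans lb.
  rewrite lerD2l lerN2; apply: err.
  have -> : x0 / b * 2 ^+ K * 2 ^+ M = 2 ^+ K * (x0 * 2 ^+ M / b).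
    by field; rewrite gt_eqF.
  by rewrite ler_peMr ?exprn_ge0// ler_pdivlMr// mul1r.
have E1 : (fun N : nat => (1 - C * N%:R `^ (- (delta / 4)))%:E) @ \oo -->
    (1%:E : \bar R).
  apply: cvg_EFin; first by near=> N.
  rewrite -[X in _ --> X]subr0 -(mulr0 C); apply: cvgB; first exact: cvg_cst.
  by apply: cvgMr; apply: cvg_natr_powRN; rewrite divr_gt0.
apply: squeeze_cvge E1 (cvg_cst _).
near=> N.
have [v -> /andP[lb ub]] : exists2 v : R,
    'E_(P N)[fun w => gibbs_avg beta (fun e => J N e w)
       (all_chi (fun e => J N e w) (U N w) (N%:R `^ kappa))]%E = v%:E &
    1 - C * N%:R `^ (- (delta / 4)) <= v <= 1 by near: N; exact: main.
by rewrite !lee_fin lb ub.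
Unshelve. all: by end_near. Qed.
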